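(* There exists a commutative ring $R$ with identity that has finitely many maximal ideals and such that the identity automorphism of $R$ is not positively expansive.
   Context: A generator of a commutative unital ring $R$ is a finite set $\mathcal I$ of ideals of $R$ with $\sum_{I\in\mathcal I}I=R$. The product of generators is $\mathcal I\mathcal J=\{IJ\mid I\in\mathcal I,\,J\in\mathcal J\}$, and similarly for finitely many factors. For families of sets, $\mathcal A\prec\mathcal B$ means that for every $A\in\mathcal A$ there is $B\in\mathcal B$ with $A\subseteq B$. For an automorphism $\alpha$ of $R$ and $i\in\mathbb Z$, $\alpha^{i}(\mathcal I)=\{\alpha^{i}(I)\mid I\in\mathcal I\}$. The automorphism $\alpha$ is positively expansive if there is a generator $\mathcal I$ such that for every generator $\mathcal J$ there is $N\ge0$ with $\prod_{i=0}^N\alpha^{-i}(\mathcal I)\prec\mathcal J$. *)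

(* Defs.v *)
From HB Require Import structures.
From mathcomp Require Import all_boot all_order all_algebra.
From mathcomp Require Import boolp classical_sets cardinality.

Set Implicit Arguments.
Unset Strict Implicit.
Unset Printing Implicit Defensive.

Local Open Scope classical_set_scope.
Local Open Scope ring_scope.

(* MathComp's [idealr] structure is not used: its instances are decidable,
   proper ideals, whereas here R itself has to count as an ideal. *)
Definition is_ideal (R : comPzRingType) (I : set R) : Prop :=
  [/\ I 0,
      (forall x y, I x -> I y -> I (x + y))
    & (forall a x, I x -> I (a * x))].

Definition is_maximal_ideal (R : comPzRingType) (M : set R) : Prop :=
  [/\ is_ideal M, M <> setT
    & forall J : set R, is_ideal J -> M `<=` J -> J = M \/ J = setT].

Definition ideal_sum (R : comPzRingType) (F : set (set R)) : set R :=
  [set x | exists s : seq R,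
     (forall y, y \in s -> exists2 I, F I & I y) /\ x = \sum_(y <- s) y].

Definition ideal_mul (R : comPzRingType) (I J : set R) : set R :=
  [set x | exists s : seq (R * R),
     (forall p, p \in s -> I p.1 /\ J p.2) /\ x = \sum_(p <- s) p.1 * p.2].

Definition is_generator (R : comPzRingType) (F : set (set R)) : Prop :=
  [/\ finite_set F, (forall I, F I -> is_ideal I) & ideal_sum F = setT].

Definition gen_mul (R : comPzRingType) (F G : set (set R)) : set (set R) :=
  [set K | exists I J, [/\ F I, G J & K = ideal_mul I J]].

(* F 0 * F 1 * ... * F N: N.+1 factors, bracketed to the left. *)
Fixpoint gen_prod (R : comPzRingType) (F : nat -> set (set R)) (N : nat)
    : set (set R) :=
  if N is n.+1 then gen_mul (gen_prod F n) (F N) else F 0%N.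

Definition refines (T : Type) (A B : set (set T)) : Prop :=
  forall X, A X -> exists2 Y, B Y & X `<=` Y.

Record ring_aut (R : comPzRingType) := RingAut {
  aut_fun :> {rmorphism R -> R};
  aut_inv : R -> R;
  aut_funK : cancel aut_fun aut_inv;
  aut_invK : cancel aut_inv aut_fun
}.

Definition id_aut (R : comPzRingType) : ring_aut R :=
  @RingAut R idfun idfun (fun=> erefl) (fun=> erefl).

Definition aut_pow (R : comPzRingType) (alpha : ring_aut R) (i : int) : R -> R :=
  match i with
  | Posz n => iter n alpha
  | Negz n => iter n.+1 (aut_inv alpha)
  end.

Definition gen_image (R : comPzRingType) (f : R -> R) (F : set (set R))
    : set (set R) :=
  [set f @` I | I in F].

Definition positively_expansive (R : comPzRingType) (alpha : ring_aut R) : Prop :=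
  exists2 F : set (set R), is_generator F &
    forall G : set (set R), is_generator G ->
      exists N : nat,
        refines (gen_prod (fun i => gen_image (aut_pow alpha (- i%:Z)) F) N) G.

(* Main.v *)
Require Import Defs.
From HB Require Import structures.
From mathcomp Require Import all_boot all_order all_algebra.
From mathcomp Require Import boolp classical_sets functions cardinality.
From mathcomp Require Import ring zify.

(** Expansiveness of the identity of a semilocal ring fails as soon as some
    maximal ideal [m] has the following property: every [u] outside [m] admits
    a [v] outside [m] that divides no power of [u].  Indeed, a generator [F]
    has a member [I] containing some [u] outside [m], and then no power of [I]
    is contained in a member of the generator [{vR, m}].

    Let Z_(6) be the ring of fractions with denominator prime to 6.  The ring
    of the sequences in Z_(6) that are constant modulo 6 has this property.  A
    sequence is a unit iff its residue is, so the only maximal ideals are those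
    of even residue and of residue divisible by 3.  For the latter, [v] is a
    sequence of powers of 2 that grows faster than any fixed power of [u]. *)

Set Implicit Arguments.
Unset Strict Implicit.
Unset Printing Implicit Defensive.

Import GRing.Theory Num.Theory.

Local Open Scope classical_set_scope.
Local Open Scope ring_scope.

(** * Ideals, generators and expansiveness of the identity *)

Lemma is_ideal_sum (R : comPzRingType) (I : set R) (s : seq R) :
  is_ideal I -> (forall y, y \in s -> I y) -> I (\sum_(y <- s) y).
Proof.
by move=> [I0 ID _] Is; rewrite big_seq; apply: (big_ind I) => // x; apply: Is.
Qed.

Lemma is_ideal_setT (R : comPzRingType) (I : set R) :
  is_ideal I -> I 1 -> I = setT.
Proof.
move=> [_ _ IM] I1; apply/seteqP; split=> // x _.
by rewrite -[x]mulr1; apply: IM.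
Qed.

Definition principal (R : comPzRingType) (v : R) : set R :=
  [set x | exists y, x = v * y].

Lemma is_ideal_principal (R : comPzRingType) (v : R) : is_ideal (principal v).
Proof.
split=> [|_ _ [y ->] [z ->]|a _ [y ->]].
- by exists 0; rewrite mulr0.
- by exists (y + z); rewrite mulrDr.
- by exists (a * y); rewrite mulrCA.
Qed.

Lemma gen_image_id_aut (R : comPzRingType) (i : int) (F : set (set R)) :
  gen_image (aut_pow (id_aut R) i) F = F.
Proof.
have -> : aut_pow (id_aut R) i = id.
  by apply/funext => x; case: i => n; rewrite /aut_pow; elim: n => //= n ->.
rewrite /gen_image; apply/seteqP; split=> [_ [I FI <-]|I FI].
  by rewrite image_id.
by exists I; rewrite // image_id.
Qed.

(** The product of [N.+1] copies of [I] serves as [K], hence the exponent [N.+1]. *)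
Lemma gen_prod_exp (R : comPzRingType) (F : nat -> set (set R)) (I : set R)
    (u : R) (N : nat) :
  (forall i, F i I) -> I u -> exists2 K, gen_prod F N K & K (u ^+ N.+1).
Proof.
move=> FI Iu; elim: N => [|N [K FK Ku]]; first by exists I => //=; apply: FI.
exists (ideal_mul K I); first by exists K, I; split=> //; apply: FI.
exists [:: (u ^+ N.+1, u)]; split; last by rewrite big_seq1 -exprSr.
by move=> p; rewrite inE => /eqP ->.
Qed.

(** The condition on [1 - v * y] is maximality of [m] in terms of elements: [v] is invertible modulo
    [m]. *)
Lemma not_expansive_id_aut (R : comPzRingType) (m : set R) :
    is_ideal m -> ~ m 1 ->
    (forall v, ~ m v -> exists y, m (1 - v * y)) ->
    (forall u, ~ m u -> exists2 v, ~ m v & forall n, ~ principal v (u ^+ n)) ->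
  ~ positively_expansive (id_aut R).
Proof.
move=> idm m1 m_max m_div [F [_ Fid Fsum] Fexp].
have [_ mD mM] := idm.
have mX u n : ~ m u -> ~ m (u ^+ n).
  move=> mu; elim: n => [|n IHn]; first by rewrite expr0.
  move=> muSn; apply: IHn; have [y my] := m_max u mu.
  (* Multiplying by the inverse [y] of [u] modulo [m] lowers the exponent. *)
  have -> : u ^+ n = u ^+ n * (1 - u * y) + y * u ^+ n.+1.
    by rewrite exprS; ring.
  by apply: mD; apply: mM.
have [I [u [FI Iu mu]]] : exists I u, [/\ F I, I u & ~ m u].
  apply: contrapT => noI; apply: m1.
  have : ideal_sum F 1 by rewrite Fsum.
  case=> s [Fs ->]; apply: is_ideal_sum => // y /Fs[I FI Iy].
  by apply: contrapT => my; apply: noI; exists I, y.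
have [v mv vu] := m_div u mu.
have genG : is_generator [set principal v; m].
  split=> [|J [->|->]|//].
  - exact: finite_set2.
  - exact: is_ideal_principal.
  - exact: idm.
  have [y my] := m_max v mv.
  apply/seteqP; split=> // x _; exists [:: v * y * x; x * (1 - v * y)]; split.
    move=> z; rewrite !inE => /orP[] /eqP ->.
      by exists (principal v); [left | exists (y * x); rewrite mulrA].
    by exists m; [right | apply: mM].
  by rewrite big_cons big_seq1; ring.
have [N FN] := Fexp _ genG.
have [|K FK Ku] := @gen_prod_exp R
  (fun i => gen_image (aut_pow (id_aut R) (- i%:Z)) F) I u N _ Iu.
  by move=> i; rewrite gen_image_id_aut.
have [J [->|->] KJ] := FN _ FK.
  by apply: (vu N.+1); apply: KJ.
by apply: (mX u N.+1 mu); apply: KJ.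
Qed.

(** * Residues modulo 6 in Z_(6) *)

(* [x] lies in Z_(6) and is congruent to [c] modulo 6: up to sign, a
   denominator prime to 6 is congruent to 1 modulo 6. *)
Definition cong6 (c : int) (x : rat) : Prop :=
  exists a b : int, x * (1 + 6 * b)%:~R = (c + 6 * a)%:~R.

Lemma cong6_int (c : int) : cong6 c c%:~R.
Proof. by exists 0, 0; rewrite !mulr0 !addr0 mulr1. Qed.

Lemma cong6B c d x y : cong6 c x -> cong6 d y -> cong6 (c - d) (x - y).
Proof.
move=> [a [b xE]] [a' [b' yE]].
(* The fractions are brought to the common denominator [(1 + 6 * b) * (1 + 6 * b')]. *)
exists (a + b' * c + 6 * a * b' - a' - b * d - 6 * a' * b),
  (b + b' + 6 * b * b').
transitivity ((c + 6 * a)%:~R * (1 + 6 * b')%:~R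
  - (d + 6 * a')%:~R * (1 + 6 * b)%:~R : rat); first by rewrite -xE -yE; ring.
by ring.
Qed.

Lemma cong6M c d x y : cong6 c x -> cong6 d y -> cong6 (c * d) (x * y).
Proof.
move=> [a [b xE]] [a' [b' yE]].
exists (a * d + c * a' + 6 * a * a'), (b + b' + 6 * b * b').
transitivity ((c + 6 * a)%:~R * (d + 6 * a')%:~R : rat).
  by rewrite -xE -yE; ring.
by ring.
Qed.

(** Cross-multiplying the two fractions leaves an equality of integers, to be read modulo 6. *)
Lemma cong6_uniq c d x : cong6 c x -> cong6 d x -> exists k, c = d + 6 * k.
Proof.
move=> [a [b xE]] [a' [b' xE']].
have /eqP : ((c + 6 * a) * (1 + 6 * b'))%:~R
    = ((d + 6 * a') * (1 + 6 * b))%:~R :> rat.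
  by rewrite !intrM -xE -xE'; ring.
rewrite eqr_int => /eqP E.
exists (a' + b * d + 6 * a' * b - a - b' * c - 6 * a * b').
apply/eqP; rewrite -subr_eq0; apply/eqP.
transitivity ((c + 6 * a) * (1 + 6 * b') - (d + 6 * a') * (1 + 6 * b)).
  by ring.
by rewrite E subrr.
Qed.

Lemma cong6D6 c k x : cong6 (c + 6 * k) x -> cong6 c x.
Proof.
by move=> [a [b xE]]; exists (k + a), b; rewrite xE; congr _%:~R; ring.
Qed.

(** For residue 1 the numerator has the same shape as the denominator, so inversion swaps [a] and
    [b]. *)
Lemma cong6V1 x : cong6 1 x -> x != 0 /\ cong6 1 x^-1.
Proof.
move=> [a [b xE]].
have a0 : (1 + 6 * a)%:~R != 0 :> rat by rewrite intr_eq0; lia.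
have x0 : x != 0 by apply: contraNneq a0 => x0; rewrite -xE x0 mul0r.
by split=> //; exists b, a; rewrite -xE mulKf.
Qed.

(** * The ring of sequences constant modulo 6 *)

Definition constmod6 : {pred nat -> rat} :=
  [pred f | `[< exists c, forall i, cong6 c (f i) >]].

Lemma constmod6P f :
  reflect (exists c, forall i, cong6 c (f i)) (f \in constmod6).
Proof. exact: asboolP. Qed.

Lemma constmod6_subring_closed : subring_closed constmod6.
Proof.
split=> [|f g /constmod6P[c fc] /constmod6P[d gd]|
  f g /constmod6P[c fc] /constmod6P[d gd]]; apply/constmod6P.
- by exists 1 => i; apply: (cong6_int 1).
- by exists (c - d) => i; apply: cong6B.
- by exists (c * d) => i; apply: cong6M.
Qed.

Record seq6 := Seq6 { seq6_val :> nat -> rat; _ : seq6_val \in constmod6 }.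

HB.instance Definition _ := [isSub for seq6_val].
HB.instance Definition _ := [Choice of seq6 by <:].
HB.instance Definition _ :=
  GRing.SubChoice_isSubComPzRing.Build _ _ seq6 constmod6_subring_closed.

Lemma seq6_eq (f g : seq6) : (forall i, f i = g i) -> f = g.
Proof. by move=> fg; apply/val_inj/funext. Qed.

Lemma seq6_mul (f g : seq6) i : (f * g) i = f i * g i.
Proof. by []. Qed.

Lemma seq6_exp (f : seq6) n i : (f ^+ n) i = f i ^+ n.
Proof. by elim: n => // n IHn; rewrite !exprS seq6_mul IHn. Qed.

Definition has_res (c : int) (f : seq6) : Prop := forall i, cong6 c (f i).

Lemma seq6_res f : exists c, has_res c f.
Proof. by case: f => f /[dup] /constmod6P. Qed.

Lemma has_res1 : has_res 1 1.
Proof. by move=> i; apply: (cong6_int 1). Qed.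

Lemma has_resB c d f g : has_res c f -> has_res d g -> has_res (c - d) (f - g).
Proof. by move=> fc gd i; apply: cong6B. Qed.

Lemma has_resD c d f g : has_res c f -> has_res d g -> has_res (c + d) (f + g).
Proof.
move=> fc gd; rewrite -[d]opprK -[g]opprK -(sub0r d) -(sub0r g).
by do 2 apply: has_resB => //; move=> i; apply: (cong6_int 0).
Qed.

Lemma has_resM c d f g : has_res c f -> has_res d g -> has_res (c * d) (f * g).
Proof. by move=> fc gd i; apply: cong6M. Qed.

Lemma has_res_uniq c d f : has_res c f -> has_res d f -> exists k, c = d + 6 * k.
Proof. by move=> fc fd; apply: (cong6_uniq (fc 0) (fd 0)). Qed.

(** An integer prime to 6 is 1 or -1 modulo 6. Entrywise inversion preserves residue 1, and negation
    reduces residue -1 to that case. *)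
Lemma seq6_unit (c : int) (f : seq6) :
  has_res c f -> ~ (2 %| c)%Z -> ~ (3 %| c)%Z -> exists g, f * g = 1.
Proof.
have unit1 h : has_res 1 h -> exists g, h * g = 1.
  move=> h1; have hV : (fun i => (h i)^-1) \in constmod6.
    by apply/constmod6P; exists 1 => i; case: (cong6V1 (h1 i)).
  exists (Seq6 hV); apply: seq6_eq => i.
  by rewrite seq6_mul mulfV //; case: (cong6V1 (h1 i)).
move=> fc c2 c3.
have [k [cE|cE]] : exists k : int, c = 1 + 6 * k \/ c = - 1 + 6 * k.
  by exists ((c + 1) %/ 6)%Z; lia.
  by apply: unit1 => i; apply: (@cong6D6 _ k); rewrite -cE.
have [|g fg] := unit1 (- f).
  move=> i; have -> : (- f) i = 0%:~R - f i by rewrite sub0r.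
  apply: (@cong6D6 _ (- k)).
  have -> : 1 + 6 * - k = 0 - c by rewrite cE; ring.
  by apply: cong6B => //; apply: cong6_int.
by exists (- g); rewrite mulrN -mulNr.
Qed.

(** * Maximal ideals and divisibility of powers *)

Definition res_ideal (p : int) : set seq6 :=
  [set f | exists k, has_res (p * k) f].

Lemma is_ideal_res_ideal p : is_ideal (res_ideal p).
Proof.
have res0 : has_res 0 0 by move=> i; apply: (cong6_int 0).
split=> [|f g [k fk] [l gl]|a f [k fk]].
- by exists 0; rewrite mulr0.
- by exists (k + l); rewrite mulrDr; apply: has_resD.
- have [c ac] := seq6_res a.
  by exists (c * k); rewrite mulrCA; apply: has_resM.
Qed.

(** A residue is determined only modulo 6; its divisibility by [p] is well defined because [p]
    divides 6. *)
Lemma res_ideal_dvd p c f :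
  (p %| 6)%Z -> has_res c f -> res_ideal p f -> (p %| c)%Z.
Proof.
move=> p6 fc [k fk]; have [j ->] := has_res_uniq fc fk.
by rewrite rpredD // ?dvdz_mulr.
Qed.

Lemma dvd_res_ideal p c f : has_res c f -> (p %| c)%Z -> res_ideal p f.
Proof. by move=> fc /dvdzP[k cE]; exists k; rewrite mulrC -cE. Qed.

Lemma maximal_seq6 (M : set seq6) :
  is_maximal_ideal M -> M = res_ideal 2 \/ M = res_ideal 3.
Proof.
move=> [idM MT Mmax]; have [_ MD MM] := idM.
have Mp p : (p %| 6)%Z -> ~ (p %| 1)%Z -> M `<=` res_ideal p -> M = res_ideal p.
  move=> p6 p1 /(Mmax _ (is_ideal_res_ideal p))[//|pT].
  by exfalso; apply: p1; apply: (res_ideal_dvd p6 has_res1); rewrite pT.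
have [M2|/existsNP[x /not_implyP[Mx x2]]] := pselect (M `<=` res_ideal 2).
  by left; apply: Mp.
have [M3|/existsNP[y /not_implyP[My y3]]] := pselect (M `<=` res_ideal 3).
  by right; apply: Mp.
have [c xc] := seq6_res x; have [d yd] := seq6_res y.
have c2 : ~ (2 %| c)%Z by move=> /(dvd_res_ideal xc).
have d3 : ~ (3 %| d)%Z by move=> /(dvd_res_ideal yd).
(* [3c + 2d] is odd because [c] is, and prime to 3 because [d] is, so [M] contains a unit. *)
have [|||g xyg] := @seq6_unit (c *+ 3 + d *+ 2) (x *+ 3 + y *+ 2).
- by rewrite !mulrS !mulr0n !addr0; do !apply: has_resD.
- lia.
- lia.
exfalso; apply: MT; apply: is_ideal_setT => //.
by rewrite -xyg mulrC !mulrS !mulr0n !addr0; apply: MM; do !apply: (MD).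
Qed.

(** A diagonal argument: entry [n] of [v] has too many factors 2 for [v] to divide [u ^+ n]. *)
Lemma undivided_power (u : seq6) : ~ res_ideal 3 u ->
  exists2 v, ~ res_ideal 3 v & forall n, ~ principal v (u ^+ n).
Proof.
move=> u3; have [c uc] := seq6_res u.
have c3 : ~ (3 %| c)%Z by move=> /(dvd_res_ideal uc).
(* A zero entry would force the residue [c] to be a multiple of 6. *)
have u0 i : numq (u i) != 0.
  rewrite numq_eq0; apply/eqP => ui0; have [a [b]] := uc i.
  by rewrite ui0 mul0r => /esym/eqP; rewrite intr_eq0; lia.
pose e i := (`|numq (u i)| ^ i)%N.
(* The exponent is odd so that all entries share the residue 2: [2 * 4 ^ k] is 2 modulo 6 for every
   [k]. *)
pose f i : rat := (2 ^+ (2 * e i).+1)%:~R.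
have fres i : cong6 2 (f i).
  have /dvdzP[q qE] : (3 %| (4 ^+ e i - 1)%R)%Z.
    by rewrite -[X in _ - X](expr1n _ (e i)) subrXX dvdz_mulr.
  apply: (@cong6D6 _ q).
  have -> : 2 + 6 * q = 2 ^+ (2 * e i).+1.
    by rewrite exprS exprM -[_ ^+ e i](subrK 1) qE; ring.
  exact: cong6_int.
have fS : f \in constmod6 by apply/constmod6P; exists 2.
have f2 : has_res 2 (Seq6 fS) by [].
exists (Seq6 fS); first by move=> /(res_ideal_dvd _ f2) => /(_ isT).
move=> n [w /(congr1 (fun h : seq6 => h n))].
rewrite seq6_exp seq6_mul /= => E.
have [d wd] := seq6_res w; have [a [b wE]] := wd n.
have {}E : numq (u n) ^+ n * (1 + 6 * b)
    = 2 ^+ (2 * e n).+1 * (d + 6 * a) * denq (u n) ^+ n.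
  apply: (@intr_inj rat).
  by rewrite !intrM !rmorphXn /= numqE exprMn E -wE /f rmorphXn /=; ring.
have : (2 ^+ (2 * e n).+1 %| numq (u n) ^+ n)%Z.
  (* The odd factor [1 + 6 * b] does not affect divisibility by a power of 2. *)
  rewrite -(@Gauss_dvdzl _ _ (1 + 6 * b)).
    by rewrite E -mulrA dvdz_mulr.
  rewrite coprimezXl //.
  by apply/coprimezP; exists (- 3 * b, 1) => /=; ring.
(* The dividend is nonzero with absolute value [e n], which is less than [2 ^ (2 * e n + 1)]. *)
rewrite dvdzE !abszX => /dvdn_leq.
rewrite expn_gt0 absz_gt0 u0 => /(_ isT); apply/negP; rewrite -ltnNge.
rewrite -/(e n); apply: (leq_ltn_trans _ (ltn_expl _ _)) => //; lia.
Qed.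

Theorem mainTheorem7 :
  exists R : comPzRingType,
    finite_set [set M : set R | is_maximal_ideal M]%classic /\
    ~ positively_expansive (id_aut R).
Proof.
exists seq6; split.
  apply: (@sub_finite_set _ _ [set res_ideal 2; res_ideal 3]).
    exact: maximal_seq6.
  exact: finite_set2.
apply: (@not_expansive_id_aut _ (res_ideal 3)) undivided_power.
- exact: is_ideal_res_ideal.
- by move=> /(res_ideal_dvd _ has_res1) => /(_ isT).
- move=> v v3; have [c vc] := seq6_res v.
  (* Since [c * c] is 1 modulo 3, [v] is its own inverse modulo [res_ideal 3]. *)
  exists v; apply: (dvd_res_ideal (has_resB has_res1 (has_resM vc vc))).
  have c3 : ~ (3 %| c)%Z by move=> /(dvd_res_ideal vc).
  have [k [->|->]] : exists k : int, c = 1 + 3 * k \/ c = - 1 + 3 * k.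
    by exists ((c + 1) %/ 3)%Z; lia.
    by apply/dvdzP; exists (- 2 * k - 3 * k * k); ring.
  by apply/dvdzP; exists (2 * k - 3 * k * k); ring.
Qed.
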